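(* Let $p$ be an odd prime and let $r\ge 1$ be an integer. Then $d(p^r)=p^{r-1}d(p)$.
   Context: For $n\ge 0$, $E_n$ denotes the $n$-th Euler up/down (zig-zag) number, i.e. the number of alternating permutations of $\{1,\dots,n\}$; equivalently, the $E_n$ are the integers determined by $\sum_{n\ge0}E_n z^n/n!=\sec z+\tan z$ (so $E_0=E_1=E_2=1$, $E_3=2$, $E_4=5$, $E_5=16$, $E_6=61$). A positive integer $P$ is an eventual period of a sequence $(a_n)_{n\ge0}$ if there is $t\ge0$ with $a_{n+P}=a_n$ for all $n\ge t$; a sequence having an eventual period is called eventually periodic. For every integer $q\ge1$ the sequence $(E_n\bmod q)_{n\ge0}$ is eventually periodic, and $d(q)$ denotes its minimal eventual period, i.e. its least eventual period. *)

(* Defs.v *)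
From mathcomp Require Import all_boot all_fingroup boolp.

Set Implicit Arguments.
Unset Strict Implicit.
Unset Printing Implicit Defensive.

(* Up/down convention: s 0 < s 1 > s 2 < s 3 > ... *)
Definition alternating (n : nat) (s : 'S_n) : bool :=
  [forall i : 'I_n, forall j : 'I_n,
    (nat_of_ord j == i.+1) ==> (if odd i then s j < s i else s i < s j)].

Definition euler_updown (n : nat) : nat := #|[set s : 'S_n | alternating s]|.

Definition eventual_period (a : nat -> nat) (P : nat) : Prop :=
  0 < P /\ exists t : nat, forall n : nat, t <= n -> a (n + P) = a n.

Lemma ex_asbool_eventual_period (a : nat -> nat) :
  (exists P, eventual_period a P) -> exists P, `[< eventual_period a P >].
Proof. by case=> P aP; exists P; apply/asboolP. Qed.

(* The junk value 0 is taken exactly when a is not eventually periodic. *)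
Definition min_eventual_period (a : nat -> nat) : nat :=
  if pselect (exists P, eventual_period a P) is left ex_P
  then ex_minn (ex_asbool_eventual_period ex_P) else 0.

Lemma min_eventual_periodP (a : nat -> nat) :
  (exists P, eventual_period a P) ->
  eventual_period a (min_eventual_period a) /\
  forall P, eventual_period a P -> min_eventual_period a <= P.
Proof.
move=> ex_P; rewrite /min_eventual_period; case: pselect => // ex_P'.
case: ex_minnP => m /asboolP am min_m; split=> // P aP.
by apply: min_m; apply/asboolP.
Qed.

Definition euler_period (q : nat) : nat :=
  min_eventual_period (fun n => euler_updown n %% q).

(* Main.v *)
Require Import Defs.
From mathcomp Require Import all_boot all_fingroup boolp.
From mathcomp Require Import all_order all_algebra all_solvable all_field.
From mathcomp Require Import zify ring.

(** Let [x = - i], [N] odd and [S_n = sum_(l < N) l^n x^l], computed in the ring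
of algebraic integers. The proof rests on the congruence
    [(x^N - 1) E_n = - 2 i^(n+1) S_n  (mod N)]  for [n > 0]
([euler_updown_powersum]), a finite form of [E_n = 2 i^(n+1) Li_(-n)(- i)].
Both [x^N - 1] and [2] are invertible mod [N], so periods of [E_n] mod [N] can
be read off from those of [i^n S_n], a combination of the geometric sequences
[(i l)^n]. The outcome is that the minimal eventual period mod [p^(v+1)] is
[p^v L] with [L = lcm(4, p-1)], from which the theorem is immediate.

The congruence comes from the Entringer numbers [e(n, k)], which count the
alternating permutations of [n+1] letters beginning with [k]. Deleting the first
letter and reversing the order of the values gives
[e(n+1, k) = sum_(j < n+1-k) e(n, j)]. Hence [C(n, k) = e(n, k) + i e(n, n-k)]
satisfies [C(n+1, k+1) - C(n+1, k) = i C(n, k)] and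
[C(n+1, n+1) = i C(n+1, 0)]; these rules determine a triangle mod [N] from its
apex, and [i^n sum_(l < N) l^(n-k) (l+1)^k x^l] obeys them mod [N] too.

That [p^v L] is a period is Euler's theorem for the units [l], the other terms
dying out. For the converse, linear combinations of shifts isolate the terms of
[sum_l c_l l^n] with [l] in one residue class [m] mod [p]
([dvdA_residue_class_sum]).
- Mod [p] a single term is left, so [(i m)^P = 1] for all [m] prime to [p] and
  every period [P]: this gives [4 %| P], from [m = 1], and then [p-1 %| P].
- Mod [p^(v+2)] write [P = p^v Q] with [L %| Q]; then
  [l^P = 1 + p^(v+1) q_l] for [l] prime to [p], and [q_(1+pt) = Q t] mod [p].
  The class [m = 1] yields [Q sum_t t y^t = 0] mod [p] with [y = x^p], and that
  sum is a unit, so [p %| Q]. Induction on [v] concludes, [p] being prime to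
  [L]. *)

Set Implicit Arguments.
Unset Strict Implicit.
Unset Printing Implicit Defensive.

Import GRing.Theory Num.Theory.

(** * Entringer numbers *)

(** The classical Entringer number [E(n, n - k)], which is defined with down-up
permutations of [n.+1] letters: complementing the values exchanges the two
descriptions. *)
Definition entringer (n k : nat) : nat :=
  #|[set s : 'S_n.+1 | alternating s && (s ord0 == k :> nat)]|.

Lemma alternatingP (n : nat) (s : 'S_n) :
  reflect (forall i j : 'I_n, j = i.+1 :> nat ->
             if odd i then s j < s i else s i < s j)
          (alternating s).
Proof.
apply: (iffP forallP) => [alt_s i j /eqP ij | alt_s i].
  by move/forallP/(_ j): (alt_s i); rewrite ij.
by apply/forallP => j; apply/implyP => /eqP; apply: alt_s.
Qed.

(** Reversing the values turns up-down into down-up, so that prepending [k] to an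
alternating permutation gives an alternating one as soon as the first step goes
up. *)
Definition prepend_rev (n : nat) (k : 'I_n.+2) (s : 'S_n.+1) : 'S_n.+2 :=
  lift_perm ord0 k (s * perm (@rev_ord_inj n.+1)).

Lemma prepend_rev0 n (k : 'I_n.+2) s : prepend_rev k s ord0 = k.
Proof. exact: lift_perm_id. Qed.

Lemma prepend_rev_lift n (k : 'I_n.+2) s i :
  prepend_rev k s (lift ord0 i) = lift k (rev_ord (s i)).
Proof. by rewrite /prepend_rev lift_perm_lift permM permE. Qed.

Lemma prepend_rev_inj n (k : 'I_n.+2) : injective (prepend_rev k).
Proof.
move=> s t st; apply/permP => i; apply: rev_ord_inj; apply: (@lift_inj _ k).
by rewrite -!prepend_rev_lift st.
Qed.

Lemma prepend_rev_onto n (t : 'S_n.+2) : exists s, t = prepend_rev (t ord0) s.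
Proof.
pose f i := rev_ord (odflt i (unlift (t ord0) (t (lift ord0 i)))).
have fE i : lift (t ord0) (rev_ord (f i)) = t (lift ord0 i).
  rewrite /f rev_ordK; case: unliftP => [j -> //|/perm_inj t0].
  by have := neq_lift ord0 i; rewrite t0 eqxx.
have f_inj : injective f.
  by move=> i j fij; apply: (@lift_inj _ ord0); apply: (@perm_inj _ t);
     rewrite -!fE fij.
exists (perm f_inj); apply/permP => i; case: (unliftP ord0 i) => [j|] ->.
  by rewrite prepend_rev_lift permE fE.
by rewrite prepend_rev0.
Qed.

Lemma alternating_prepend_rev n (k : 'I_n.+2) (s : 'S_n.+1) :
  alternating (prepend_rev k s) = alternating s && (s ord0 < n.+1 - k).
Proof.
apply/alternatingP/andP => [alt|[/alternatingP alt s0k] i j ij].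
  split.
    apply/alternatingP => i j ij.
    have := alt (lift ord0 i) (lift ord0 j); rewrite !prepend_rev_lift /=.
    rewrite /bump ij => /(_ erefl); case: (odd i) => /=; lia.
  have := alt ord0 (lift ord0 ord0) erefl.
  rewrite prepend_rev0 prepend_rev_lift /= /bump.
  by have := ltn_ord (s ord0); case: leqP => /=; lia.
case: (unliftP ord0 j) ij => [j' ->|-> //]; case: (unliftP ord0 i) => [i' ->|->].
  move=> ij; have {ij} ij : j' = i'.+1 :> nat by case: ij.
  have := alt _ _ ij; rewrite !prepend_rev_lift /= /bump /=.
  by have := ltn_ord (s i'); have := ltn_ord (s j'); case: (odd i') => /=; lia.
move=> /= [j0]; have -> : j' = ord0 by apply: val_inj.
rewrite prepend_rev0 prepend_rev_lift /= /bump.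
by have := ltn_ord (s ord0); case: leqP => /=; lia.
Qed.

Lemma entringer0 k : entringer 0 k = (k == 0).
Proof.
rewrite /entringer.
have alt (s : 'S_1) : alternating s.
  by apply/alternatingP => i j; rewrite !ord1.
rewrite (eq_card (B := [set s : 'S_1 | k == 0])); last first.
  by move=> s; rewrite !inE alt /= ord1 eq_sym.
case: (k == 0); last by rewrite cards0.
by rewrite cardsT card_Sn.
Qed.

Lemma card_first_value n m :
  #|[set s : 'S_n.+1 | alternating s && (s ord0 < m)]| =
  \sum_(j < m) entringer n j.
Proof.
elim: m => [|m IH].
  by rewrite big_ord0; apply: eq_card0 => s; rewrite !inE andbF.
rewrite big_ord_recr /= -IH -cardsUI.
rewrite [X in _ = _ + X]eq_card0 ?addn0; last first.
  by move=> s; rewrite !inE; case: alternating => //=; lia.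
by apply: eq_card => s; rewrite !inE -andb_orr ltnS leq_eqVlt orbC.
Qed.

Lemma entringerS n k :
  entringer n.+1 k = \sum_(j < n.+1 - k) entringer n j.
Proof.
case: (ltnP k n.+2) => [ltkn|lenk]; last first.
  rewrite (_ : n.+1 - k = 0) ?big_ord0; last by lia.
  apply: eq_card0 => s; rewrite !inE; apply/andP => -[_ /eqP sk].
  by have := ltn_ord (s ord0); rewrite sk; lia.
rewrite -card_first_value -(card_imset _ (@prepend_rev_inj n (Ordinal ltkn))).
apply: eq_card => t; rewrite inE; apply/andP/imsetP => [[alt_t /eqP tk]|[s]].
  have [s ts] := prepend_rev_onto t; rewrite ts in alt_t.
  have tk' : t ord0 = Ordinal ltkn by apply: val_inj.
  exists s; last by rewrite -tk'.
  by rewrite inE -(alternating_prepend_rev (Ordinal ltkn)) -tk'.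
rewrite inE -(alternating_prepend_rev (Ordinal ltkn)) => alt_s ->.
by rewrite alt_s prepend_rev0.
Qed.

Lemma euler_updown_entringer n : 0 < n -> euler_updown n = entringer n 0.
Proof.
case: n => // n _; rewrite entringerS subn0 -card_first_value.
by apply: eq_card => s; rewrite !inE ltn_ord andbT.
Qed.

(** The boustrophedon rule: consecutive partial sums of a row differ by one entry. *)
Lemma entringerSS n k : (k <= n)%N ->
  entringer n.+1 k = (entringer n.+1 k.+1 + entringer n (n - k))%N.
Proof. by move=> lekn; rewrite !entringerS subSS subSn // big_ord_recr. Qed.

Lemma entringer_diag n : entringer n.+1 n.+1 = 0.
Proof. by rewrite entringerS subnn big_ord0. Qed.

(** * Powers of integers modulo prime powers *)

Lemma prime_expn_predn p a : prime p -> ~~ (p %| a) -> a ^ p.-1 = 1 %[mod p].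
Proof.
by move=> p_pr pa; rewrite -totient_prime // Euler_exp_totient // coprime_sym
  prime_coprime.
Qed.

(** Powers of [l] are killed when [p %| l], which is why the period is only eventual,
and repeat by Euler's theorem otherwise. *)
Lemma expn_eventually_periodic p v P l n : prime p ->
  p.-1 * p ^ v %| P -> v < n ->
  l ^ (n + P) = l ^ n %[mod p ^ v.+1].
Proof.
move=> p_pr /dvdnP[k ->] ltvn; have [pl | pl] := boolP (p %| l).
  have zero m : v < m -> l ^ m = 0 %[mod p ^ v.+1].
    move=> ltvm; apply/eqP; rewrite mod0n -/(_ %| _).
    by apply: dvdn_trans (dvdn_exp2r _ pl); apply: dvdn_exp2l.
  by rewrite !zero // ltn_addr.
have cop : coprime l (p ^ v.+1) by rewrite coprime_sym coprimeXl ?prime_coprime.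
rewrite -[_ * p ^ v]/(p.-1 * p ^ v.+1.-1) -totient_pfactor // mulnC expnD expnM.
by rewrite -modnMmr -modnXm Euler_exp_totient // modnXm exp1n modnMmr muln1.
Qed.

Lemma expn_1D_taylor2 a n : exists k,
  (1 + a) ^ n = 1 + n * a + 'C(n, 2) * a ^ 2 + k * a ^ 3.
Proof.
elim: n => [|n [k IHn]]; first by exists 0.
exists ('C(n, 2) + k * (1 + a)); rewrite expnS IHn binS bin1; ring.
Qed.

(** The quadratic term of the expansion gains a factor [p] from ['C(p, 2)], which is
where oddness matters. *)
Lemma expn_1D_prime p j u : prime p -> odd p -> exists k,
  (1 + p ^ j.+1 * u) ^ p = 1 + p ^ j.+2 * (u + p * k).
Proof.
move=> p_pr p_odd; have [k ->] := expn_1D_taylor2 (p ^ j.+1 * u) p.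
have p_gt2 : 2 < p by rewrite odd_prime_gt2.
have /dvdnP[h ->] : p %| 'C(p, 2) by rewrite prime_dvd_bin.
(* [h * p = 'C(p, 2)]; both remaining terms contain [p ^ j.+3]. *)
exists (h * p ^ j * u ^ 2 + k * p ^ (j + j) * u ^ 3).
by rewrite !expnMn !expnS !expnD expn0; ring.
Qed.

(** The linear dependence on [t] of the Fermat-type quotient
[((1 + p * t) ^ (p ^ v * Q) - 1) / p ^ v.+1] mod [p]. *)
Lemma expn_1Dp p v Q t : prime p -> odd p -> exists k,
  (1 + p * t) ^ (p ^ v * Q) = 1 + p ^ v.+1 * (Q * t + p * k).
Proof.
move=> p_pr p_odd; elim: v => [|v [k IHv]].
  rewrite expn0 mul1n expn1; have [k ->] := expn_1D_taylor2 (p * t) Q.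
  exists ('C(Q, 2) * t ^ 2 + k * p * t ^ 3); ring.
rewrite expnSr -mulnA (mulnC p Q) mulnA expnM IHv.
have [h ->] := expn_1D_prime v (Q * t + p * k) p_pr p_odd.
by exists (k + h); congr (1 + _ * _); ring.
Qed.

(** The remainder [s] of [P] mod [p.-1] has the same property, and for [s > 0] the
polynomial ['X^s - 1] would have too many roots in ['F_p]. *)
Lemma dvdn_pred_expn_unit p P : prime p ->
  (forall m, 0 < m < p -> m ^ P = 1 %[mod p]) -> p.-1 %| P.
Proof.
move=> p_pr units1; apply/eqP; set s := P %% p.-1.
have p_gt1 := prime_gt1 p_pr.
apply/eqP; rewrite -leqn0 leqNgt; apply/negP => s_gt0.
have lt_s : s < p.-1 by rewrite ltn_mod; lia.
pose q : {poly 'F_p} := ('X^s - 1)%R.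
have size_q : size q = s.+1 by rewrite size_XnsubC.
have q_neq0 : q != 0%R by rewrite -size_poly_eq0 size_q.
have := @max_poly_roots _ q (enum (predC1 (0%R : 'F_p))) q_neq0 _ (enum_uniq _).
rewrite size_q -cardE cardC1 card_Fp // => h.
suff : p.-1 < s.+1 by lia.
apply: h; apply/allP => x; rewrite mem_enum inE => x_neq0.
rewrite rootE !hornerE -(natr_Zp x) -natrX.
have lt_x : 0 < (x : nat) < p.
  by rewrite lt0n x_neq0 -[X in _ < X](Fp_cast p_pr) ltn_ord.
have x1 : (x : nat) ^ p.-1 = 1 %[mod p].
  by apply: prime_expn_predn; rewrite // gtnNdvd //; case/andP: lt_x.
have := units1 _ lt_x; rewrite {1}(divn_eq P p.-1) -/s expnD [_ * p.-1]mulnC expnM.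
rewrite -modnMml -modnXm x1 modnXm exp1n modnMml mul1n => xs.
by rewrite -(Fp_nat_mod p_pr) xs (Fp_nat_mod p_pr) subrr.
Qed.

(** * Congruences between algebraic integers *)

Local Open Scope ring_scope.
Local Notation iC := ('i : algC).

Lemma sqr_i : iC * iC = -1.
Proof. by rewrite -expr2 sqrCi. Qed.

Lemma expr4_i : iC ^+ 4 = 1.
Proof. by rewrite (exprM _ 2 2) sqrCi sqrrN expr1n. Qed.

Lemma Aint_i : iC \in Aint.
Proof. by apply: (@Aint_unity_root 4) => //; apply/unity_rootP/expr4_i. Qed.

Lemma Aint_nat n : n%:R \in Aint.
Proof. exact: rpred_nat. Qed.

#[local] Hint Resolve Aint_i Aint_nat : core.

Ltac Aint_tac := repeat lazymatch goal with
  | |- is_true (in_mem (@GRing.mul _ _ _) _) => apply: rpredM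
  | |- is_true (in_mem (@GRing.exp _ _ _) _) => apply: rpredX
  | |- is_true (in_mem (1%R) _) => apply: rpred1
  | |- is_true (in_mem (@GRing.natmul _ (1%R) _) _) => exact: Aint_nat
  | |- is_true (in_mem (@GRing.natmul _ _ _) _) => apply: rpredMn
  | |- is_true (in_mem (@GRing.opp _ _) _) => rewrite rpredN
  | |- is_true (in_mem (@GRing.add _ _ _) _) => apply: rpredD
  | |- is_true (in_mem (@bigop _ _ _ _ _) _) => apply: rpred_sum => ? _
  | |- _ => first [exact: Aint_i | done]
  end.

Lemma dvdA_natP (N : nat) (x : algC) : (0 < N)%N ->
  reflect (exists2 y, y \in Aint & x = N%:R * y) (N %| x)%A.
Proof.
move=> N_gt0; have N_neq0 : (N%:R : algC) != 0 by rewrite pnatr_eq0 -lt0n.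
rewrite unfold_in (negPf N_neq0).
apply: (iffP idP) => [Zy | [y Zy ->]]; last by rewrite mulrC mulKf.
by exists (x / N%:R); rewrite // mulrC divfK.
Qed.

Lemma dvdA_mull (N : nat) (x y : algC) :
  x \in Aint -> (N %| y)%A -> (N %| x * y)%A.
Proof. by rewrite -!eqAmod0 => Zx /(eqAmodMl Zx); rewrite mulr0. Qed.

Lemma dvdA_natl (N : nat) (x : algC) : x \in Aint -> (N %| N%:R * x)%A.
Proof. by move=> Zx; rewrite -eqAmod0; apply: eqAmodMr0. Qed.

Lemma dvdA_nat (N m : nat) : (N %| (m%:R : algC))%A = (N %| m)%N.
Proof. by rewrite -eqAmod0; apply: eqAmod0_nat. Qed.

Lemma dvdA_coprime_cancel (N a : nat) (x : algC) : (0 < N)%N ->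
  coprime a N -> x \in Aint -> (N %| a%:R * x)%A -> (N %| x)%A.
Proof.
move=> N_gt0 aN Zx Nax.
case: (posnP a) aN Nax => [-> | a_gt0 aN Nax].
  rewrite /coprime gcd0n => /eqP-> _.
  by apply/dvdA_natP => //; exists x; rewrite ?mul1r.
have [u v uv _] := egcdnP N a_gt0; rewrite (eqP aN) in uv.
have -> : x = u%:R * (a%:R * x) - N%:R * (v%:R * x).
  by rewrite !mulrA -!natrM -mulrBl uv (mulnC v) natrD addrAC subrr add0r mul1r.
by apply: rpredB; [apply: dvdA_mull | apply: dvdA_natl; rewrite rpredM].
Qed.

Lemma dvdA_natl_cancel (N a : nat) (x : algC) : (0 < N)%N -> (0 < a)%N ->
  ((a * N)%N %| a%:R * x)%A -> (N %| x)%A.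
Proof.
move=> N_gt0 a_gt0; have aN_gt0 : (0 < a * N)%N by rewrite muln_gt0 a_gt0.
case/(dvdA_natP _ aN_gt0) => y Zy; rewrite natrM -mulrA => axy.
apply/dvdA_natP => //; exists y => //; apply: mulfI axy.
by rewrite pnatr_eq0 -lt0n.
Qed.

Lemma dvdA_i_expr (N k : nat) (x : algC) : (N %| iC ^+ k * x)%A = (N %| x)%A.
Proof.
apply/idP/idP => [|/dvdA_mull->//]; last by rewrite rpredX.
(* The inverse of ['i ^+ k] is ['i ^+ (3 * k)]. *)
have Z3k : iC ^+ (3 * k) \in Aint by rewrite rpredX.
by move/(dvdA_mull Z3k); rewrite mulrA -exprD -mulSnr exprM expr4_i expr1n mul1r.
Qed.

Lemma dvdA_natB (N m n : nat) :
  (N %| (m%:R - n%:R : algC))%A = (m == n %[mod N])%N.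
Proof. exact: eqAmod_nat. Qed.

Lemma i_expr_eq1 P : (4 %| P)%N -> iC ^+ P = 1.
Proof. by case/dvdnP => k ->; rewrite mulnC exprM expr4_i expr1n. Qed.

(** Unless [iC ^+ P = 1], the number [iC ^+ P - 1] divides [2], which is prime to [N]. *)
Lemma dvdA_i_expr_sub1 (N P : nat) : odd N -> (1 < N)%N ->
  (N %| iC ^+ P - 1)%A -> (4 %| P)%N.
Proof.
move=> N_odd N_gt1; rewrite {1}(divn_eq P 4) exprD (i_expr_eq1 (dvdn_mull _ _)) //.
rewrite mul1r /dvdn; have : (P %% 4 < 4)%N by rewrite ltn_mod.
have no2 : (N %| (2%:R : algC))%A -> False.
  rewrite dvdA_nat => /(dvdn_leq _)/= le2; have := le2 isT.
  by case: N N_odd N_gt1 {le2} => [|[|[|]]].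
have Zi := Aint_i; have Z1 : (1 : algC) \in Aint by rewrite rpred1.
case: (P %% 4)%N => [|[|[|[|//]]]] // _ Nk; case: no2.
- have -> : (2%:R : algC) = - (1 + iC) * (iC ^+ 1 - 1).
    rewrite expr1 [RHS](_ : _ = 1 - iC * iC); last by ring.
    by rewrite sqr_i opprK.
  by apply: dvdA_mull => //; Aint_tac.
- have -> : (2%:R : algC) = -1 * (iC ^+ 2 - 1).
    by rewrite sqrCi; ring.
  by apply: dvdA_mull => //; Aint_tac.
have -> : (2%:R : algC) = (iC - 1) * (iC ^+ 3 - 1).
  rewrite exprSr sqrCi [RHS](_ : _ = 1 - iC * iC); last by ring.
  by rewrite sqr_i opprK.
by apply: dvdA_mull => //; Aint_tac.
Qed.

(** For odd [N] the factor [(- iC) ^+ N - 1] is [- 1 - iC] or [- 1 + iC], of norm 2;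
it is therefore invertible modulo any odd number. *)
Lemma i_expr_norm N : odd N -> ((- iC) ^+ N - 1) * (iC ^+ N - 1) = 2%:R.
Proof.
move=> N_odd; rewrite exprNn -signr_odd N_odd expr1 mulN1r.
rewrite [LHS](_ : _ = 1 - iC ^+ N * iC ^+ N); last by ring.
by rewrite -exprMn sqr_i -signr_odd N_odd expr1 opprK.
Qed.

(** * Euler numbers as power sums *)

(** A triangle obeying the two rules is determined mod [N] by its apex: if row [n]
vanishes then row [n.+1] is constant, and its two ends differ by the factor
[iC]. *)
Lemma boustrophedon_vanish (N : nat) (w : nat -> nat -> algC) : odd N ->
  (forall n k, w n k \in Aint) ->
  (N %| w 0 0)%A ->
  (forall n k, (k <= n)%N -> w n.+1 k.+1 = w n.+1 k + iC * w n k) ->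
  (forall n, (N %| w n.+1 n.+1 - iC * w n.+1 0)%A) ->
  forall n k, (k <= n)%N -> (N %| w n k)%A.
Proof.
move=> N_odd Zw w00 wS wmax.
have N_gt0 : (0 < N)%N by case: (N) N_odd.
elim=> [|n IHn]; first by case.
have w_const k : (k <= n.+1)%N -> (N %| w n.+1 k - w n.+1 0)%A.
  elim: k => [|k IHk] ltkn; first by rewrite subrr rpred0.
  by rewrite wS // addrAC rpredD ?IHk ?dvdA_mull ?IHn // ltnW.
have {}w0 : (N %| w n.+1 0)%A.
  apply: (@dvdA_coprime_cancel _ 2); rewrite ?coprime2n //.
  (* Row [n.+1] is constant mod [N], so its head is killed by [1 - iC], a divisor
     of [2]. *)
  have -> : 2%:R * w n.+1 0 = (1 + iC) *
     ((w n.+1 n.+1 - iC * w n.+1 0) - (w n.+1 n.+1 - w n.+1 0)).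
    rewrite [RHS](_ : _ = (1 - iC * iC) * w n.+1 0); last by ring.
    by rewrite sqr_i opprK.
  by apply: dvdA_mull; [rewrite rpredD | apply: rpredB; rewrite ?w_const].
by move=> k lekn; rewrite -(subrK (w n.+1 0) (w n.+1 k)) rpredD ?w_const.
Qed.

Definition powersum (N n : nat) : algC := \sum_(l < N) l%:R ^+ n * (- iC) ^+ l.

(** Interpolates between [powersum] at [k = 0] and its shift by one at [k = n], which
is [iC] times [powersum] up to a boundary term. *)
Definition mixed_powersum (N n k : nat) : algC :=
  \sum_(l < N) l%:R ^+ (n - k) * l.+1%:R ^+ k * (- iC) ^+ l.

Lemma Aint_mixed_powersum N n k : mixed_powersum N n k \in Aint.
Proof. rewrite /mixed_powersum; Aint_tac. Qed.

Lemma Aint_powersum N n : powersum N n \in Aint.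
Proof. by rewrite /powersum; Aint_tac. Qed.

Lemma mixed_powersumS N n k : (k <= n)%N ->
  mixed_powersum N n.+1 k.+1 = mixed_powersum N n.+1 k + mixed_powersum N n k.
Proof.
move=> lekn; rewrite -big_split; apply: eq_bigr => l _ /=.
rewrite subSS subSn // !exprS -[l.+1]addn1 natrD; ring.
Qed.

Lemma mixed_powersum0 N n : mixed_powersum N n 0 = powersum N n.
Proof. by apply: eq_bigr => l _; rewrite subn0 expr0 mulr1. Qed.

Lemma mixed_powersum_diag N n :
  mixed_powersum N n.+1 n.+1 = iC * (powersum N n.+1 + N%:R ^+ n.+1 * (- iC) ^+ N).
Proof.
have -> : powersum N n.+1 + N%:R ^+ n.+1 * (- iC) ^+ N = powersum N.+1 n.+1.
  by rewrite /powersum big_ord_recr.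
rewrite /powersum big_ord_recl expr0n mul0r add0r mulr_sumr.
apply: eq_bigr => l _; rewrite subnn expr0 mul1r lift0 [(- iC) ^+ l.+1]exprS.
rewrite mulrCA [iC * _]mulrA mulrN sqr_i opprK mul1r //.
Qed.

(** The difference of the two triangles, normalised to agree at the apex, falls
under [boustrophedon_vanish]. *)
Lemma entringer_mixed_powersum (N n k : nat) : odd N -> (k <= n)%N ->
  (N %| ((- iC) ^+ N - 1) * ((entringer n k)%:R + iC * (entringer n (n - k))%:R)
        + 2%:R * iC ^+ n.+1 * mixed_powersum N n k)%A.
Proof.
move=> N_odd; move: n k; apply: boustrophedon_vanish => //.
- by move=> n k; Aint_tac; apply: Aint_mixed_powersum.
- rewrite mixed_powersum0 subnn entringer0 eqxx mulr1 subrX1.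
  have -> : powersum N 0 = \sum_(j < N) (- iC) ^+ j.
    by apply: eq_bigr => l _; rewrite mul1r.
  rewrite [X in (_ %| X)%A](_ : _ = - (1 + iC * iC) * \sum_(j < N) (- iC) ^+ j).
    by rewrite sqr_i subrr oppr0 mul0r rpred0.
  rewrite -[true%:R]/(1 : algC); ring.
- move=> n k lekn; rewrite mixed_powersumS // subSS subSn //.
  rewrite (entringerSS lekn) (@entringerSS n (n - k)) ?leq_subr // subKn //.
  rewrite !natrD [_ ^+ n.+2]exprS.
  set u := (- iC) ^+ N.
  apply/eqP; rewrite -subr_eq0; apply/eqP.
  pose e : algC := (entringer n (n - k))%:R.
  transitivity (- (u - 1) * e * (1 + iC * iC)); first by rewrite /e; ring.
  by rewrite sqr_i subrr mulr0.
move=> n; rewrite mixed_powersum_diag mixed_powersum0 subnn subn0 entringer_diag.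
set e := (entringer _ _)%:R; set u := (_ - 1).
rewrite [X in (_ %| X)%A](_ : _ = N%:R *
   (2%:R * iC ^+ n.+3 * N%:R ^+ n * (- iC) ^+ N)).
  by apply: dvdA_natl; Aint_tac.
rewrite !exprS; ring.
Qed.

Lemma euler_updown_powersum (N n : nat) : odd N -> (0 < n)%N ->
  (N %| ((- iC) ^+ N - 1) * (euler_updown n)%:R
        + 2%:R * iC ^+ n.+1 * powersum N n)%A.
Proof.
case: n => // n N_odd _; have := entringer_mixed_powersum N_odd (leq0n n.+1).
by rewrite mixed_powersum0 subn0 entringer_diag mulr0 addr0 euler_updown_entringer.
Qed.

(** The unit factors of [euler_updown_powersum] depend on [n] only through [iC ^+ n],
so that the shift by [P] leaves the single factor [iC ^+ P]. *)
Lemma euler_updown_shift (N P n : nat) : odd N -> (0 < n)%N ->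
  (euler_updown (n + P) == euler_updown n %[mod N])%N =
  (N %| iC ^+ P * powersum N (n + P) - powersum N n)%A.
Proof.
move=> N_odd n_gt0; rewrite -dvdA_natB.
have N_gt0 : (0 < N)%N by case: (N) N_odd.
have F := rpredB (euler_updown_powersum (n := n + P) N_odd (ltn_addr _ n_gt0))
                (euler_updown_powersum N_odd n_gt0).
set u := (- iC) ^+ N - 1 in F; set dE := _ - _; set dS := _ - _.
have {}F : (N %| u * dE + 2%:R * (iC ^+ n.+1 * dS))%A.
  suff -> : u * dE + 2%:R * (iC ^+ n.+1 * dS) =
    (u * (euler_updown (n + P))%:R + 2%:R * iC ^+ (n + P).+1 * powersum N (n + P))
    - (u * (euler_updown n)%:R + 2%:R * iC ^+ n.+1 * powersum N n) by [].
  by rewrite /dE /dS -addSn exprD; ring.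
have ZdS : dS \in Aint by rewrite /dS; Aint_tac; apply: Aint_powersum.
have ZdE : dE \in Aint by rewrite /dE; Aint_tac.
apply/idP/idP => [NdE | NdS].
  rewrite -(dvdA_i_expr _ n.+1); apply: (@dvdA_coprime_cancel _ 2) => //.
  - by rewrite coprime2n.
  - by Aint_tac.
  by rewrite -(addKr (u * dE) (_ * _)) rpredD // rpredN dvdA_mull // /u; Aint_tac.
apply: (@dvdA_coprime_cancel _ 2) => //; first by rewrite coprime2n.
rewrite -(i_expr_norm N_odd) -/u [u * _]mulrC -mulrA; apply: dvdA_mull.
  by Aint_tac.
rewrite -(addrK (2%:R * (iC ^+ n.+1 * dS)) (u * dE)); apply: rpredB => //.
by rewrite -(dvdA_i_expr _ n.+1) in NdS; apply: dvdA_mull; Aint_tac.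
Qed.

Lemma powersum_twist_diff N P n :
  iC ^+ P * powersum N (n + P) - powersum N n =
  \sum_(l < N) (- iC) ^+ l * (iC ^+ P * l%:R ^+ P - 1) * l%:R ^+ n.
Proof.
rewrite /powersum mulr_sumr -sumrB; apply: eq_bigr => l _.
rewrite exprD; move: (_ ^+ n) (_ ^+ P) (_ ^+ l) (_ ^+ P) => a b e f; ring.
Qed.

(** * Isolating a residue class *)

(** The hypothesis extends linearly from the powers [l ^ n] to polynomials in [l]
divisible by [l ^ t], in particular to one that is the indicator of the class
of [m] modulo [p]. *)
Lemma dvdA_residue_class_sum (p N t m : nat) (c : nat -> algC) : prime p ->
  ~~ (p %| m)%N -> (forall l, c l \in Aint) ->
  (forall n, (t <= n)%N -> (p %| \sum_(l < N) c l * l%:R ^+ n)%A) ->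
  (p %| \sum_(l < N | (l == m %[mod p])%N) c l)%A.
Proof.
move=> p_pr pm Zc c0.
have p1_gt0 : (0 < p.-1)%N by rewrite -subn1 subn_gt0 prime_gt1.
(* As [p.-1 * m] is [- m] mod [p], Fermat's theorem makes [q.[l%:R]] the
   indicator mod [p] of the class of [m]. *)
pose q : {poly algC} := 1 - ('X + (p.-1 * m)%:R%:P) ^+ p.-1.
have Zq i : q`_i \in Aint.
  suff /polyOverP : q \is a polyOver Aint by [].
  apply: rpredB; rewrite ?rpred1 //; apply: rpredX; apply: rpredD.
    exact: polyOverX.
  by rewrite polyOverC; apply: Aint_nat.
(* Large enough for [c0], and a multiple of [p.-1] so that [m ^ s] is 1. *)
pose s := (t * p.-1)%N.
have sum_q : (p %| \sum_(l < N) c l * (l%:R ^+ s * q.[l%:R]))%A.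
  rewrite (eq_bigr (fun l : 'I_N =>
     \sum_(i < size q) q`_i * (c l * l%:R ^+ (s + i)))); last first.
    move=> l _; rewrite horner_coef !mulr_sumr; apply: eq_bigr => i _.
    by rewrite exprD; ring.
  rewrite exchange_big rpred_sum // => i _; rewrite -mulr_sumr dvdA_mull // c0 //.
  by rewrite (leq_trans _ (leq_addr _ _)) // leq_pmulr.
rewrite -(subKr (\sum_(l < N) c l * (l%:R ^+ s * q.[l%:R])) (\sum_(l < N | _) _)).
apply: rpredB => //; rewrite [X in _ - X]big_mkcond -sumrB rpred_sum // => l _.
have -> : q.[l%:R] = 1 - ((l + p.-1 * m) ^ p.-1)%:R.
  by rewrite !hornerE natrX natrD.
have lmE : (l == m %[mod p])%N = (p %| l + p.-1 * m)%N.
  rewrite -(eqn_modDr (p.-1 * m)) -mulSn prednK ?prime_gt0 //.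
  by rewrite modnMr.
case: ifP => lm; last first.
  rewrite subr0 mulrA; apply: dvdA_mull; first by Aint_tac.
  by rewrite -[1]/(1%:R) dvdA_natB eq_sym; apply/eqP/prime_expn_predn; rewrite -?lmE ?lm.
rewrite -[X in _ - X]mulr1 -mulrBr; apply: dvdA_mull => //.
rewrite mulrBr mulr1 addrAC; apply: rpredB.
  rewrite -natrX -[1]/(1%:R) dvdA_natB /s mulnC expnM -modnXm prime_expn_predn //.
    by rewrite modnXm exp1n.
  by apply: contra pm; rewrite /dvdn (eqP lm).
apply: dvdA_mull; first by Aint_tac.
by rewrite dvdA_nat dvdn_exp // -lmE.
Qed.

Lemma big_residue1 (p M : nat) (c : nat -> algC) : (1 < p)%N ->
  \sum_(l < M * p | (l == 1 %[mod p])%N) c l = \sum_(t < M) c (t * p + 1)%N.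
Proof.
move=> p_gt1; rewrite big_mkcond.
rewrite -(big_mkord xpredT (fun l => if (l == 1 %[mod p])%N then c l else 0)).
rewrite big_nat_mul big_mkord; apply: eq_bigr => t _.
rewrite -{1}[(t * p)%N]add0n big_addn mulSn addnK big_mkord.
rewrite (bigD1 (Ordinal p_gt1)) //= addnC modnMDl eqxx big1 ?addr0 // => j j1.
rewrite addnC modnMDl !modn_small // ifN //.
Qed.

Lemma sum_nat_expr (y : algC) (M : nat) :
  (y - 1) ^+ 2 * (\sum_(t < M) t%:R * y ^+ t) =
  M%:R * (y ^+ M * (y - 1)) - y * (y ^+ M - 1).
Proof.
elim: M => [|M IHM]; first by rewrite big_ord0 expr0; ring.
by rewrite big_ord_recr mulrDr IHM /= [y ^+ M.+1]exprS -natr1; ring.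
Qed.

(** * The period modulo a prime power *)

(** Modulo [p] the class of [m] in [l < p] is a single term, so [(iC * m) ^+ P] is 1
for every [m] prime to [p]. *)
Lemma dvdn_period_mod_prime p P t : prime p -> odd p ->
  (forall n, (t <= n)%N -> (euler_updown (n + P) = euler_updown n %[mod p])%N) ->
  (lcmn 4 p.-1 %| P)%N.
Proof.
move=> p_pr p_odd perP.
pose c l := (- iC) ^+ l * (iC ^+ P * l%:R ^+ P - 1).
have Zc l : c l \in Aint by rewrite /c; Aint_tac.
have c0 n : (t.+1 <= n)%N -> (p %| \sum_(l < p) c l * l%:R ^+ n)%A.
  move=> ltn; rewrite -powersum_twist_diff -euler_updown_shift ?perP //.
  - exact: ltnW.
  by case: (n) ltn.
have unit1 m : (0 < m < p)%N -> (p %| iC ^+ P * (m ^ P)%:R - 1)%A.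
  case/andP=> m_gt0 ltmp; have pm : ~~ (p %| m)%N by rewrite gtnNdvd.
  have := dvdA_residue_class_sum p_pr pm Zc c0.
  rewrite (big_pred1 (Ordinal ltmp)) => [|l]; last first.
    by rewrite !modn_small // -val_eqE.
  rewrite /c /= natrX exprNn -mulrA mulrCA dvdA_i_expr.
  by case/(dvdA_mull (rpredX m (rpredN1 _))); rewrite signrMK.
have p_gt1 := prime_gt1 p_pr.
have P4 : (4 %| P)%N.
  apply: (@dvdA_i_expr_sub1 p) => //.
  by have := unit1 1%N p_gt1; rewrite exp1n mulr1.
rewrite dvdn_lcm P4 /=; apply: dvdn_pred_expn_unit => // m /unit1.
by rewrite (i_expr_eq1 P4) mul1r -[1]/(1%:R) dvdA_natB => /eqP.
Qed.

(** The terms with [p %| l] vanish for large [n]; the others are divisible by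
[p ^ v.+1], and dividing by it leaves a relation mod [p] with coefficients the
quotients [q l]. The class of 1, where these quotients are known from
[expn_1Dp], then forces [p %| Q]. *)
Lemma prime_dvd_period_cofactor p v Q t : prime p -> odd p ->
  (4 %| p ^ v * Q)%N -> (p.-1 %| Q)%N ->
  (forall n, (t <= n)%N ->
    (euler_updown (n + p ^ v * Q) = euler_updown n %[mod p ^ v.+2])%N) ->
  (p %| Q)%N.
Proof.
move=> p_pr p_odd P4 p1Q perP; set P := (p ^ v * Q)%N in P4 perP.
have p_gt1 := prime_gt1 p_pr; have p_gt0 := prime_gt0 p_pr.
set N := (p ^ v.+2)%N; have N_odd : odd N by rewrite oddX p_odd orbT.
have pv_gt0 j : (0 < p ^ j)%N by rewrite expn_gt0 p_gt0.
(* [l ^ P = 1 + p ^ v.+1 * q l] for [l] prime to [p]. *)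
pose q l := ((l ^ P - 1) %/ p ^ v.+1)%N.
have qE l : ~~ (p %| l)%N -> (l ^ P = 1 + p ^ v.+1 * q l)%N.
  move=> pl; have l_gt0 : (0 < l)%N by case: l pl; rewrite ?dvdn0.
  rewrite mulnC divnK; first by rewrite subnKC // expn_gt0 l_gt0.
  rewrite -eqn_mod_dvd ?expn_gt0 ?l_gt0 //.
  have cop : coprime l (p ^ v.+1) by rewrite coprime_sym coprimeXl ?prime_coprime.
  have /dvdnP[k ->] : (totient (p ^ v.+1) %| P)%N.
    by rewrite totient_pfactor // mulnC dvdn_mul.
  by rewrite mulnC expnM -modnXm Euler_exp_totient // modnXm exp1n.
pose c l : algC := if (p %| l)%N then 0 else (- iC) ^+ l * (q l)%:R.
have Zc l : c l \in Aint by rewrite /c; case: ifP => _; [rewrite rpred0 | Aint_tac].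
have c0 n : (maxn t v.+2 <= n)%N -> (p %| \sum_(l < N) c l * l%:R ^+ n)%A.
  rewrite geq_max => /andP[letn ltvn].
  apply: (@dvdA_natl_cancel _ (p ^ v.+1)) => //; rewrite -expnSr -/N.
  have := perP n letn; move/eqP; rewrite euler_updown_shift //; last by case: (n) ltvn.
  rewrite powersum_twist_diff (i_expr_eq1 P4) => sumP.
  rewrite -(subKr (\sum_(l < N) (- iC) ^+ l * (1 * l%:R ^+ P - 1) * l%:R ^+ n)
                  (_%:R * _)).
  apply: rpredB => //; rewrite mulr_sumr -sumrB; apply: rpred_sum => l _.
  rewrite /c; case: ifP => pl; last first.
    rewrite -[l%:R ^+ P]natrX (qE l) ?pl // natrD natrM.
    rewrite [X in X \in _](_ : _ = 0) ?rpred0 //; ring.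
  rewrite mul0r mulr0 subr0; apply: dvdA_mull; first by Aint_tac.
  rewrite -natrX dvdA_nat; apply: dvdn_trans (dvdn_exp2r _ pl).
  exact: dvdn_exp2l.
have p1 : ~~ (p %| 1)%N by rewrite gtnNdvd.
have := dvdA_residue_class_sum p_pr p1 Zc c0.
pose M := (p ^ v.+1)%N; have NM : N = (M * p)%N by rewrite -expnSr.
rewrite NM big_residue1 //.
pose y := (- iC) ^+ p.
have qQ s : (q (s * p + 1)%N = Q * s %[mod p])%N.
  have [k kE] := expn_1Dp v Q s p_pr p_odd.
  have ps : ~~ (p %| s * p + 1)%N by rewrite dvdn_addr ?dvdn_mull.
  have := qE _ ps; rewrite {1}[(s * p + 1)%N]addnC {1}[(s * p)%N]mulnC kE.
  move/addnI/eqP; rewrite eqn_pmul2l // => /eqP <-.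
  by rewrite [(p * k)%N]mulnC addnC modnMDl.
move=> sum_c.
have {sum_c} sum_y : (p %| Q%:R * \sum_(s < M) s%:R * y ^+ s)%A.
  have {sum_c} : (p %| iC * \sum_(s < M) c (s * p + 1)%N)%A.
    by apply: dvdA_mull => //; Aint_tac.
  have -> : iC * \sum_(s < M) c (s * p + 1)%N =
      \sum_(s < M) y ^+ s * (q (s * p + 1)%N)%:R.
    rewrite mulr_sumr; apply: eq_bigr => s _; rewrite /c ifN; last first.
      by rewrite dvdn_addr ?dvdn_mull.
    rewrite mulrA exprD expr1 mulrCA mulrN sqr_i opprK mulr1.
    by rewrite mulnC exprM.
  move=> sum_q; rewrite -(subKr (\sum_(s < M) y ^+ s * (q (s * p + 1)%N)%:R) (_ * _)).
  apply: rpredB => //; rewrite mulr_sumr -sumrB; apply: rpred_sum => s _.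
  rewrite mulrA [_ * y ^+ _]mulrC -mulrBr -natrM.
  by apply: dvdA_mull; [rewrite /y; Aint_tac | rewrite dvdA_natB; apply/eqP].
(* [sum_nat_expr] evaluates the sum mod [p] as a unit, since [p %| M]. *)
have : (p %| Q%:R * ((y - 1) ^+ 2 * \sum_(s < M) s%:R * y ^+ s))%A.
  by rewrite mulrCA; apply: dvdA_mull => //; rewrite /y; Aint_tac.
rewrite sum_nat_expr => sum_y2.
have : (p %| Q%:R * (y * (y ^+ M - 1)))%A.
  rewrite -(subKr (Q%:R * (M%:R * (y ^+ M * (y - 1)))) (Q%:R * (y * _))).
  rewrite -mulrBr; apply: rpredB => //; rewrite /M expnS natrM mulrCA -mulrA.
  by apply: dvdA_natl; rewrite /y; Aint_tac.
have yM : y ^+ M = (- iC) ^+ N by rewrite NM mulnC exprM.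
rewrite mulrCA yM /y exprNn -mulrA => /(dvdA_mull (rpredX p (rpredN1 _))).
rewrite signrMK dvdA_i_expr => /(dvdA_mull (_ : iC ^+ N - 1 \in Aint)).
rewrite mulrCA [_ * (_ - 1)]mulrC i_expr_norm // -natrM dvdA_nat => Q2.
have /Q2 : iC ^+ N - 1 \in Aint by Aint_tac.
by rewrite Gauss_dvdl // coprimen2.
Qed.

Lemma dvdn_period_mod_prime_power p v P t : prime p -> odd p ->
  (forall n, (t <= n)%N ->
    (euler_updown (n + P) = euler_updown n %[mod p ^ v.+1])%N) ->
  (p ^ v * lcmn 4 p.-1 %| P)%N.
Proof.
move=> p_pr p_odd; elim: v => [|v IHv] perP.
  by rewrite mul1n; apply: dvdn_period_mod_prime (perP).
have /dvdnP[k Pk] : (p ^ v * lcmn 4 p.-1 %| P)%N.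
  apply: IHv => n letn; have /eqP := perP n letn.
  by rewrite [(p ^ v.+2)%N]expnS => /eqP/(congr1 (modn^~ (p ^ v.+1)%N));
    rewrite !modn_dvdm ?dvdn_mull.
have {Pk} Pk : P = (p ^ v * (lcmn 4 p.-1 * k))%N by rewrite Pk; ring.
rewrite {}Pk in perP *.
have : (p %| lcmn 4 p.-1 * k)%N.
  apply: (prime_dvd_period_cofactor p_pr p_odd _ _ perP).
    by rewrite dvdn_mull // dvdn_mulr // dvdn_lcml.
  by rewrite dvdn_mulr // dvdn_lcmr.
rewrite Gauss_dvdr; first by rewrite expnSr -mulnA dvdn_pmul2l ?expn_gt0 ?prime_gt0 // mulnC
   => pk; rewrite dvdn_pmul2l // lcmn_gt0 -subn1 subn_gt0 prime_gt1.
have p_gt2 : (2 < p)%N by rewrite odd_prime_gt2.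
rewrite prime_coprime //; apply/negP => pL.
have : (p %| 4 * p.-1)%N by apply: dvdn_trans pL _; rewrite dvdn_lcm dvdn_mulr ?dvdn_mull.
rewrite Euclid_dvdM // -[4%N]/(2 ^ 2)%N Euclid_dvdX // andbT => /orP[] /dvdn_leq; lia.
Qed.

Lemma euler_updown_periodic p v n : prime p -> odd p -> (v < n)%N ->
  (euler_updown (n + p ^ v * lcmn 4 p.-1) = euler_updown n %[mod p ^ v.+1])%N.
Proof.
move=> p_pr p_odd ltvn; set P := (p ^ v * _)%N.
have P4 : (4 %| P)%N by rewrite dvdn_mull ?dvdn_lcml.
have P1 : (p.-1 * p ^ v %| P)%N by rewrite mulnC dvdn_mul ?dvdn_lcmr.
apply/eqP; rewrite euler_updown_shift ?oddX ?p_odd ?orbT //; last by case: (n) ltvn.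
rewrite i_expr_eq1 // mul1r -sumrB; apply: rpred_sum => l _.
rewrite -mulrBl mulrC; apply: dvdA_mull; first by Aint_tac.
by rewrite -!natrX dvdA_natB; apply/eqP/expn_eventually_periodic.
Qed.

Lemma euler_period_prime_power p v : prime p -> odd p ->
  euler_period (p ^ v.+1) = (p ^ v * lcmn 4 p.-1)%N.
Proof.
move=> p_pr p_odd; rewrite /euler_period; set a := fun n => _.
have p_gt1 := prime_gt1 p_pr.
have perL : eventual_period a (p ^ v * lcmn 4 p.-1)%N.
  split; last by exists v.+1 => n ltvn; apply: euler_updown_periodic.
  by rewrite muln_gt0 expn_gt0 lcmn_gt0 prime_gt0 //= -subn1 subn_gt0.
have [[m_gt0 [t m_per]] m_min] :=
  min_eventual_periodP (ex_intro _ _ perL).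
apply/eqP; rewrite eqn_leq m_min //= dvdn_leq //.
exact: dvdn_period_mod_prime_power m_per.
Qed.

Local Close Scope ring_scope.

Theorem theorem5p9 (p r : nat) (p_prime : prime p) (p_odd : odd p)
  (r_ge1 : 1 <= r) :
  euler_period (p ^ r) = p ^ (r - 1) * euler_period p.
Proof.
case: r r_ge1 => // v _; rewrite -{3}[p]expn1 !euler_period_prime_power //.
by rewrite subn1 mul1n.
Qed.
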